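(* Let $n\ge 3$. For every $m\ge 2$, the pair $(\bar a_n,\bar b_n)$ generates $\mathrm{SL}_n(\mathbb Z/m\mathbb Z)$, with $$\mathrm{ord}(\bar b_n)=m,$$ and $$\mathrm{ord}(\bar a_n)\mid n\quad\text{if }n\text{ is odd},\qquad \mathrm{ord}(\bar a_n)\mid 2n\quad\text{if }n\text{ is even}.$$
   Context: $E_{i,j}$ is the standard $n\times n$ matrix unit, $\varepsilon_n=(-1)^{n-1}$, and $$a_n=\sum_{i=1}^{n-1}E_{i,i+1}+\varepsilon_nE_{n,1},\qquad b_n=I_n+E_{2,1}.$$ $\bar a_n,\bar b_n$ are the images of $a_n,b_n\in\mathrm{SL}_n(\mathbb Z)$ under reduction modulo $m$, $\mathrm{SL}_n(\mathbb Z)\to\mathrm{SL}_n(\mathbb Z/m\mathbb Z)$; $\mathrm{ord}$ denotes the order of a group element. *)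

(* Defs.v *)
From HB Require Import structures.
From mathcomp Require Import all_boot all_order all_fingroup all_algebra.

Set Implicit Arguments.
Unset Strict Implicit.
Unset Printing Implicit Defensive.

Import GroupScope GRing.Theory.
Local Open Scope ring_scope.

(* MathComp only has GL_n, and only over finite rings, whereas reduction modulo
   m needs SL_n over int as well. *)
Inductive SLtype (n : nat) (R : comNzRingType) : predArgType :=
  SL (A : 'M[R]_n) of \det A == 1.

Definition SLval n (R : comNzRingType) (u : SLtype n R) : 'M[R]_n :=
  let: SL A _ := u in A.

Arguments SLtype n%_N R%_type.
Notation "{ ''SL_' n [ R ] }" := (SLtype n R)
  (n at level 2, format "{ ''SL_' n [ R ] }") : type_scope.

HB.instance Definition _ n (R : comNzRingType) := [isSub for @SLval n R].
HB.instance Definition _ n (R : comNzRingType) :=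
  [Choice of {'SL_n[R]} by <:].

Section SLGroup.
Variables (n : nat) (R : comNzRingType).
Implicit Types u v w : {'SL_n[R]}.

Lemma det_SL u : \det (SLval u) = 1.
Proof. by apply/eqP; case: u. Qed.

Fact SL_one_subproof : \det (1%:M : 'M[R]_n) == 1.
Proof. by rewrite det1. Qed.

Fact SL_mul_subproof u v : \det (SLval u *m SLval v) == 1.
Proof. by rewrite det_mulmx !det_SL mulr1. Qed.

Fact SL_inv_subproof u : \det (\adj (SLval u)) == 1.
Proof.
have := congr1 determinant (mul_mx_adj (SLval u)).
by rewrite det_mulmx !det_SL mul1r det1 => ->.
Qed.

Definition SL_one : {'SL_n[R]} := SL SL_one_subproof.
Definition SL_mul u v : {'SL_n[R]} := SL (SL_mul_subproof u v).
Definition SL_inv u : {'SL_n[R]} := SL (SL_inv_subproof u).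

Fact SL_mulA : associative SL_mul.
Proof. by move=> u v w; apply: val_inj; rewrite /= mulmxA. Qed.

Fact SL_mul1 : left_id SL_one SL_mul.
Proof. by move=> u; apply: val_inj; rewrite /= mul1mx. Qed.

Fact SL_mulr1 : right_id SL_one SL_mul.
Proof. by move=> u; apply: val_inj; rewrite /= mulmx1. Qed.

Fact SL_mulV : left_inverse SL_one SL_inv SL_mul.
Proof. by move=> u; apply: val_inj; rewrite /= mul_adj_mx det_SL. Qed.

Fact SL_mulrV : right_inverse SL_one SL_inv SL_mul.
Proof. by move=> u; apply: val_inj; rewrite /= mul_mx_adj det_SL. Qed.

HB.instance Definition _ :=
  isGroup.Build {'SL_n[R]} SL_mulA SL_mul1 SL_mulr1 SL_mulV SL_mulrV.

Lemma SLval1 : SLval (1%g : {'SL_n[R]}) = 1%:M. Proof. by []. Qed.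
Lemma SLvalM u v : SLval (u * v)%g = SLval u *m SLval v. Proof. by []. Qed.
Lemma SLvalV u : SLval u^-1%g = \adj (SLval u). Proof. by []. Qed.

End SLGroup.

HB.instance Definition _ n (R : finComNzRingType) :=
  [Finite of {'SL_n[R]} by <:].

Section SLMorphism.
Variables (n : nat) (R S : comNzRingType) (f : {rmorphism R -> S}).

Fact SLmap_subproof (u : {'SL_n[R]}) : \det (map_mx f (SLval u)) == 1.
Proof. by rewrite det_map_mx det_SL rmorph1. Qed.

Definition SLmap (u : {'SL_n[R]}) : {'SL_n[S]} := SL (SLmap_subproof u).

Lemma SLmapM : {morph SLmap : u v / (u * v)%g}.
Proof. by move=> u v; apply: val_inj; rewrite /= map_mxM. Qed.

Lemma SLmap1 : SLmap 1%g = 1%g.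
Proof. by apply: val_inj; rewrite /= map_mx1. Qed.
End SLMorphism.

(* 'Z_m is Z/mZ only when 1 < m. *)
Definition SLred n m : {'SL_n[int]} -> {'SL_n['Z_m]} :=
  SLmap (intr : int -> 'Z_m).

Lemma SLredE n m (u : {'SL_n[int]}) i j :
  SLval (SLred m u) i j = (SLval u i j)%:~R.
Proof. by rewrite mxE. Qed.

(* Indices are naturals counted from 1; Emx n i j is zero when i or j does not
   lie between 1 and n. *)
Definition Emx n (i j : nat) : 'M[int]_n :=
  \matrix_(k < n, l < n) ((k.+1 == i) && (l.+1 == j))%:R.

Lemma Emx_delta n (i j : 'I_n) : Emx n i.+1 j.+1 = delta_mx i j.
Proof. by apply/matrixP => k l; rewrite !mxE !eqSS. Qed.

Definition a_mx n : 'M[int]_n :=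
  \sum_(1 <= i < n) Emx n i i.+1 + (-1) ^+ n.-1 *: Emx n n 1.

Definition b_mx n : 'M[int]_n := 1%:M + Emx n 2 1.

Lemma a_mxE n (k l : 'I_n) :
  a_mx n k l = (l == k.+1 :> nat)%:R
               + (-1) ^+ n.-1 * ((k.+1 == n) && (l == 0 :> nat))%:R.
Proof.
rewrite /a_mx !mxE eqSS summxE; congr (_ + _).
under eq_bigr => i _ do rewrite mxE.
case: (ltnP k.+1 n) => [lt_kn | le_nk].
  rewrite (big_rem k.+1) /=; last by rewrite mem_index_iota.
  rewrite eqxx eqSS /= big_seq big1 ?addr0 // => i.
  by rewrite mem_rem_uniq ?iota_uniq // inE eq_sym => /andP[/negPf->].
rewrite big_nat big1 => [|i /andP[_ lt_in]].
  by rewrite ltn_eqF // (leq_trans (ltn_ord l)).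
by rewrite (gtn_eqF (leq_trans lt_in le_nk)).
Qed.

Lemma det_a_mx n : \det (a_mx n) = 1.
Proof.
case: n => [|n]; first by rewrite det_mx00.
rewrite (expand_det_col _ ord0) (bigD1 ord_max) //= big1 => [|i ne_i].
  rewrite addr0 a_mxE eqxx /= add0r mulr1 /cofactor addn0.
  rewrite (_ : row' _ _ = 1%:M) ?det1 ?mulr1 -?expr2 ?sqrr_sign //.
  apply/matrixP => i j; rewrite mxE [LHS]mxE a_mxE mxE lift0 lift_max eqSS.
  by rewrite eq_sym -val_eqE eqSS /= andbF mulr0 addr0.
by rewrite a_mxE eqSS (_ : (i == n :> nat) = false) ?mulr0 ?addr0 ?mul0r //;
  apply: negPf.
Qed.

Lemma det_b_mx n : \det (b_mx n) = 1.
Proof.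
rewrite det_trig.
  by rewrite big1 // => i _; rewrite !mxE eqxx eqSS; case: (val i) => [|[]].
apply/is_trig_mxP => i j lt_ij; rewrite !mxE -val_eqE (ltn_eqF lt_ij) add0r.
by rewrite !eqSS; case: (nat_of_ord j) lt_ij => [|k] //; rewrite andbF.
Qed.

Definition a_SL n : {'SL_n[int]} := SL (introT eqP (det_a_mx n)).
Definition b_SL n : {'SL_n[int]} := SL (introT eqP (det_b_mx n)).

(* Main.v *)
Require Import Defs.
From mathcomp Require Import all_boot all_order all_fingroup all_algebra.
From mathcomp Require Import cyclic ring.

(** Two independent facts give generation.

    Over Z/mZ every matrix of determinant 1 is a product of transvections
    1 + x E_ij with i <> j (elementary_SL).  The representatives 0, ..., m - 1
    serve as a Euclidean size: subtracting a smaller nonzero representative from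
    a larger one involves no wraparound.  Row operations therefore shrink a
    column of an invertible matrix until a single entry u survives; expanding
    the determinant along that column shows that u is a unit, and a few more row
    operations turn the column into the first basis vector.  The matrix is then
    block triangular with corner 1, and induction on the size finishes.  The
    ring Z/mZ may have zero divisors, so the size function is only asked to
    allow one reduction step, not a full Euclidean division.

    The subgroup H generated by a and b contains every transvection
    (contains_all).  The powers of b are all the transvections 1 + x E_10, with
    indices counted from 0.  Index the rows by the additive group of integers
    modulo n; then a has its nonzero entries, all equal to 1 or -1, at the
    places (i, i + 1), so conjugation by a shifts both indices by 1 and changes
    x at most by a sign (contains_conj).  Hence H contains 1 + x E_(i, i-1) for
    all i and x.  The commutator formula [1 + x E_ij, 1 + E_jk] = 1 + x E_ik
    (transvection_comm) then gives 1 + x E_(i, i-k) by induction on k < n.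

    The orders come from explicit powers: b ^ k = 1 + k E_10 is the identity
    exactly when m divides k, and a ^ n is the scalar matrix of the product of
    the nonzero entries of a, that is, of the sign (-1)^(n-1). *)

Set Implicit Arguments.
Unset Strict Implicit.
Unset Printing Implicit Defensive.

Import GRing.Theory.
Local Open Scope ring_scope.

(** * Transvections and elementary matrices *)

Section Transvections.
Variable R : comNzRingType.

Definition transvection n (i j : 'I_n) (x : R) : 'M[R]_n :=
  1%:M + x *: delta_mx i j.

Lemma transvectionD n (i j : 'I_n) x y : i != j ->
  transvection i j x *m transvection i j y = transvection i j (x + y).
Proof.
move=> ij; rewrite /transvection mulmxDl mul1mx mulmxDr mulmx1.
rewrite -scalemxAl -scalemxAr mul_delta_mx_0 1?eq_sym // !scaler0 addr0.
by rewrite scalerDl addrAC addrA addrAC.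
Qed.

Lemma transvection0 n (i j : 'I_n) : transvection i j 0 = 1%:M.
Proof. by rewrite /transvection scale0r addr0. Qed.

Lemma tr_transvection n (i j : 'I_n) x :
  (transvection i j x)^T = transvection j i x.
Proof. by rewrite /transvection linearD linearZ /= trmx1 trmx_delta. Qed.

Lemma det_transvection n (i j : 'I_n) x :
  i != j -> \det (transvection i j x) = 1.
Proof.
wlog ji : i j / (j < i)%N => [lower | ij].
  move=> ij; case: (ltngtP j i) => [/lower->|lt_ij|/val_inj eq_ji] //.
  - by rewrite -det_tr tr_transvection lower // eq_sym.
  - by rewrite eq_ji eqxx in ij.
rewrite det_trig.
  rewrite big1 // => k _; rewrite !mxE eqxx; case: (k =P i) => [->|] /=.
    by rewrite (negPf ij) mulr0 addr0.
  by rewrite mulr0 addr0.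
apply/is_trig_mxP => k l kl; rewrite !mxE -val_eqE (ltn_eqF kl) add0r.
case: (k =P i) => [eq_k|]; last by rewrite mulr0.
case: (l =P j) => [eq_l|]; last by rewrite mulr0.
by rewrite eq_k eq_l ltnNge (ltnW ji) in kl.
Qed.

Lemma transvection_col n (i j k : 'I_n) x (c : 'cV[R]_n) :
  (transvection i j x *m c) k 0 = c k 0 + (k == i)%:R * (x * c j 0).
Proof.
rewrite mulmxDl mul1mx -scalemxAl !mxE; congr (_ + _).
rewrite (bigD1 j) //= big1 ?addr0 => [|l /negPf lj]; rewrite mxE ?eqxx ?andbT.
  by rewrite mulrCA.
by rewrite lj andbF mul0r.
Qed.

(** This commutator is what propagates membership in a subgroup along paths
    i -> j -> k of index pairs. *)
Lemma transvection_comm n (i j k : 'I_n) x :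
  i != j -> j != k -> k != i ->
  transvection i j x *m transvection j k 1 *m
    (transvection i j (- x) *m transvection j k (- 1)) = transvection i k x.
Proof.
move=> ij jk ki.
pose P := delta_mx i j : 'M[R]_n; pose Q := delta_mx j k : 'M[R]_n.
pose D := delta_mx i k : 'M[R]_n.
have PQ : P *m Q = D by rewrite mul_delta_mx.
have PP : P *m P = 0 by rewrite mul_delta_mx_0 // eq_sym.
have QP : Q *m P = 0 by rewrite mul_delta_mx_0.
have QQ : Q *m Q = 0 by rewrite mul_delta_mx_0 // eq_sym.
have PD : P *m D = 0 by rewrite mul_delta_mx_0 // eq_sym.
have DP : D *m P = 0 by rewrite mul_delta_mx_0.
have DQ : D *m Q = 0 by rewrite mul_delta_mx_0 // eq_sym.
have QD : Q *m D = 0 by rewrite mul_delta_mx_0.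
have DD : D *m D = 0 by rewrite mul_delta_mx_0.
rewrite /transvection -/P -/Q -/D; move: P Q D PQ PP QP QQ PD DP DQ QD DD.
move=> P Q D PQ PP QP QQ PD DP DQ QD DD.
have simpl y z : (1%:M + y *: P) *m (1%:M + z *: Q)
                 = 1%:M + y *: P + z *: Q + (y * z) *: D.
  rewrite mulmxDl mul1mx mulmxDr mulmx1 -scalemxAl -scalemxAr PQ scalerA.
  by rewrite addrACA addrA.
rewrite !simpl !(mulmxDl, mulmxDr, mul1mx, mulmx1) -!(scalemxAl, scalemxAr).
rewrite PQ PP QP QQ PD DP DQ QD DD !(scaler0, addr0, scalerA).
by apply/matrixP => r s; rewrite !mxE; ring.
Qed.

(** The elementary subgroup E_n(R), as a predicate on matrices: there the block
    embedding into size n + 1 needs no determinant condition.  Closure under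
    inverses is derived in elementary_inv. *)
Inductive elementary n : 'M[R]_n -> Prop :=
| elementary1 : elementary 1%:M
| elementary_transvection i j x : i != j -> elementary (transvection i j x)
| elementaryM A B : elementary A -> elementary B -> elementary (A *m B).

Lemma elementary_det n (A : 'M_n) : elementary A -> \det A = 1.
Proof.
elim=> {A} [|i j x ij|A B _ dA _ dB]; first exact: det1.
  exact: det_transvection.
by rewrite det_mulmx dA dB mulr1.
Qed.

Lemma elementary_inv n (A : 'M_n) :
  elementary A -> exists2 B, elementary B & B *m A = 1%:M.
Proof.
elim=> {A} [|i j x ij|A B _ [A' eA A'A] _ [B' eB B'B]].
- by exists 1%:M; [exact: elementary1 | rewrite mul1mx].
- exists (transvection i j (- x)); first exact: elementary_transvection.
  by rewrite transvectionD // addNr transvection0.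
- exists (B' *m A'); first exact: elementaryM.
  by rewrite mulmxA -(mulmxA B') A'A mulmx1.
Qed.

Lemma elementary_block n (A : 'M_n) :
  elementary A -> elementary (block_mx 1%:M 0 0 A : 'M_(1 + n)).
Proof.
elim=> {A} [|i j x ij|A B _ eA _ eB].
- by rewrite -scalar_mx_block; apply: elementary1.
- have -> : block_mx 1%:M 0 0 (transvection i j x) =
            transvection (rshift 1 i) (rshift 1 j) x :> 'M_(1 + n).
    rewrite /transvection (scalar_mx_block 1 n 1).
    have -> : delta_mx (rshift 1 i) (rshift 1 j) =
              block_mx 0 0 0 (delta_mx i j) :> 'M[R]_(1 + n).
      apply/matrixP => k l; rewrite !mxE.
      by case: splitP => k' kE; rewrite !mxE; case: splitP => l' lE;
         rewrite mxE -!val_eqE /= kE lE ?ord1 ?eqn_add2l ?andbF.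
    by rewrite scale_block_mx add_block_mx !scaler0 !addr0.
  by apply: elementary_transvection; rewrite (inj_eq (@rshift_inj _ _)).
- have := elementaryM eA eB.
  by rewrite mulmx_block !(mulmx0, mul0mx, mulmx1, addr0, add0r).
Qed.

(** A row is a sum of multiples of unit rows, and block matrices of this shape
    multiply by adding their rows: each unit row contributes a transvection. *)
Lemma elementary_unirow n (v : 'rV_n) :
  elementary (block_mx 1%:M v 0 1%:M : 'M_(1 + n)).
Proof.
rewrite (row_sum_delta v).
elim/big_rec: _ => [|j w _ ew].
  by rewrite -scalar_mx_block; apply: elementary1.
have -> : block_mx 1%:M (v 0 j *: delta_mx 0 j + w) 0 1%:M =
  transvection (lshift n 0) (rshift 1 j) (v 0 j) *m block_mx 1%:M w 0 1%:M
     :> 'M_(1 + n).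
  rewrite /transvection (scalar_mx_block 1 n 1).
  have -> : delta_mx (lshift n 0) (rshift 1 j) =
            block_mx 0 (delta_mx 0 j) 0 0 :> 'M[R]_(1 + n).
    apply/matrixP => k l; rewrite !mxE.
    by case: splitP => k' kE; rewrite !mxE; case: splitP => l' lE;
       rewrite mxE -!val_eqE /= kE lE ?ord1 ?eqn_add2l ?andbF.
  rewrite scale_block_mx add_block_mx !scaler0 !addr0 !add0r.
  by rewrite mulmx_block !(mulmx0, mul0mx, mulmx1, mul1mx, addr0, add0r) addrC.
by apply: elementaryM => //; apply: elementary_transvection.
Qed.

End Transvections.

(** * Reduction of determinant-one matrices over Euclidean-like rings *)

Section EuclideanReduction.
Variables (R : comNzRingType) (d : R -> nat).
Hypothesis euclid : forall x y : R, y != 0 -> (d y <= d x)%N ->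
  exists q, (d (x + q * y) < d x)%N.

(** The end of the Euclidean algorithm: a single surviving entry, which is a
    unit u with inverse y.  If u is not in row 0, adding y times its row to row
    0 creates the entry 1 there, which then clears u. *)
Lemma elementary_unimodular_unit n (c : 'cV[R]_n.+2) (i : 'I_n.+2) y :
  (forall k, k != i -> c k 0 = 0) -> y * c i 0 = 1 ->
  exists2 E, elementary E & E *m c = delta_mx 0 0.
Proof.
wlog i0 : i c y / i != 0 => [nonzero | c0 yc].
  case: (eqVneq i 0) => [-> c0 yc | i0]; last exact: nonzero.
  have n10 : 1 != 0 :> 'I_n.+2 by [].
  (* The unit u in row 0 is moved to row 1 by (u, 0) -> (u, 1) -> (0, 1). *)
  pose F : 'M[R]_n.+2 := transvection 0 1 (- c 0 0) *m transvection 1 0 y.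
  have [k k1||E eE EF] := @nonzero 1 (F *m c) 1 n10.
  - rewrite -mulmxA !transvection_col (negPf k1) mul0r addr0.
    rewrite (c0 1) // eqxx add0r mul1r yc mulr1.
    have [->|/c0->] := eqVneq k 0; rewrite ?mul1r ?addrN //.
    by rewrite mul0r addr0.
  - rewrite -mulmxA !transvection_col (c0 1) // eqxx add0r yc.
    by rewrite (negPf n10) mul0r addr0 !mul1r.
  exists (E *m F); last by rewrite -mulmxA.
  by do !apply: elementaryM => //; apply: elementary_transvection.
exists (transvection i 0 (- c i 0) *m transvection 0 i y).
  apply: elementaryM; apply: elementary_transvection => //.
  by rewrite eq_sym.
apply/colP => k; rewrite -mulmxA !transvection_col mxE eqxx yc !mul1r !mulr1.
rewrite (c0 0) 1?eq_sym // add0r mulr1 andbT.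
have [->|ki] := eqVneq k i.
  by rewrite [0 == i]eq_sym (negPf i0) mul1r addr0 addrN.
by rewrite c0 // add0r mul0r addr0.
Qed.

(** The Euclidean algorithm on the entries of a column, by induction on the
    total size of the entries.  The row b witnesses that the column is
    unimodular; it is transformed along with c, and at the end it supplies the
    inverse of the last nonzero entry. *)
Lemma elementary_unimodular n (c : 'cV[R]_n.+2) (b : 'rV[R]_n.+2) :
  b *m c = 1%:M -> exists2 E, elementary E & E *m c = delta_mx 0 0.
Proof.
have [s] := ubnP (\sum_i d (c i 0%R)); elim: s c b => // s IHs c b c_lt bc.
have [|] := boolP [exists i, exists j, [&& i != j, c i 0 != 0, c j 0 != 0 &
                                  (d (c j 0%R) <= d (c i 0%R))%N]].
  case/existsP => i /existsP[j /and4P[ij ci cj dji]].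
  have [q qlt] := euclid cj dji.
  have [||E eE EF] := IHs (transvection i j q *m c) (b *m transvection i j (- q)).
  - rewrite ltnS in c_lt; apply: leq_trans c_lt.
    rewrite (bigD1 i) //= [X in (_ < X)%N](bigD1 i) //= transvection_col.
    rewrite eqxx mul1r -addSn leq_add // leq_sum // => k /negPf ki.
    by rewrite transvection_col ki mul0r addr0.
  - by rewrite mulmxA -(mulmxA b) transvectionD // addNr transvection0 mulmx1.
  exists (E *m transvection i j q); last by rewrite -mulmxA.
  by apply: elementaryM => //; apply: elementary_transvection.
move=> none.
have bc1 : \sum_j b 0 j * c j 0 = 1.
  by have /matrixP/(_ 0 0) := bc; rewrite !mxE.
have [i ci|c0] := pickP (fun i => c i 0 != 0); last first.
  have /eqP[] := oner_neq0 R; rewrite -bc1 big1 // => j _.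
  by have /eqP-> := negbFE (c0 j); rewrite mulr0.
have c0 k : k != i -> c k 0 = 0.
  move=> ki; apply: contraNeq none => ck.
  case: (leqP (d (c k 0)) (d (c i 0))) => [le|/ltnW le].
    by apply/existsP; exists i; apply/existsP; exists k; rewrite eq_sym ki ci ck.
  by apply/existsP; exists k; apply/existsP; exists i; rewrite ki ci ck.
apply: (@elementary_unimodular_unit n c i (b 0 i)) => //.
rewrite -bc1 (bigD1 i) //= big1 ?addr0 // => j ji.
by rewrite c0 // mulr0.
Qed.

(** The adjugate provides the unimodularity witness for the first column.  Once
    that column is the first unit vector, the matrix is
    [1 v; 0 D] = [1 0; 0 D] [1 v; 0 1] with det D = 1. *)
Theorem elementary_SL n (A : 'M[R]_n.+1) : \det A = 1 -> elementary A.
Proof.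
elim: n A => [|n IHn] A dA.
  rewrite (_ : A = 1%:M); first exact: elementary1.
  by rewrite [A]mx11_scalar -det_mx11 dA.
have [|E eE Ec] := @elementary_unimodular n (col 0 A) (row 0 (\adj A)).
  rewrite -row_mul colE mulmxA mul_adj_mx dA mul1mx.
  by apply/matrixP => i j; rewrite !mxE !ord1.
have [F eF FE] := elementary_inv eE.
suff eEA : elementary (E *m A).
  by rewrite -[A]mul1mx -FE -mulmxA; apply: elementaryM.
have dB : \det (E *m A) = 1 by rewrite det_mulmx (elementary_det eE) mul1r.
have B0 : col 0 (E *m A) = delta_mx 0 0 by rewrite colE -mulmxA -colE.
move: (E *m A) dB B0 => B; rewrite -[n.+2]/(1 + n.+1)%N in B * => dB B0.
move: dB; rewrite -[B]submxK.
have Bi0 i : B i (lshift _ 0) = (i == 0)%:R.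
  have -> : lshift n.+1 (0 : 'I_1) = 0 by apply: val_inj.
  by have /colP/(_ i) := B0; rewrite !mxE andbT.
have -> : ulsubmx B = 1%:M.
  by apply/matrixP => i j; rewrite !ord1 !mxE Bi0.
have -> : dlsubmx B = 0.
  by apply/matrixP => i j; rewrite !ord1 !mxE Bi0.
rewrite det_ublock det1 mul1r => /IHn /elementary_block eD.
have := elementaryM eD (elementary_unirow (ursubmx B)).
by rewrite mulmx_block !(mulmx0, mul0mx, mulmx1, mul1mx, addr0, add0r).
Qed.
End EuclideanReduction.

(** For 0 < y <= x < m the difference of the representatives is the
    representative of the difference, so q = -1 already decreases x. *)
Lemma Zp_euclid m (x y : 'Z_m) : y != 0 -> (y <= x)%N ->
  exists q : 'Z_m, ((x + q * y)%R < x)%N.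
Proof.
move=> y0 yx; exists (- 1); rewrite mulN1r.
have y_gt0 : (0 < y)%N.
  by rewrite lt0n; apply: contra y0 => /eqP y0; apply/eqP/val_inj.
have -> : x - y = (x - y)%N%:R by rewrite natrB // !natr_Zp.
rewrite Zp_nat /= modn_small; last first.
  exact: leq_ltn_trans (leq_subr _ _) (ltn_ord x).
by rewrite ltn_subrL y_gt0 (leq_trans y_gt0 yx).
Qed.

(** * Monomial matrices of the cyclic shift *)

Section CyclicMonomial.
Variables (R : comNzRingType) (n : nat).
Local Notation p := n.+2.

(** Indices are added modulo the size, so the last row has its entry in
    column 0. *)
Definition cyclic_mx (s : 'I_p -> R) : 'M[R]_p :=
  \matrix_(i, j) (s i *+ (j == i + 1)).

(** Row i of the k-th power follows the path i, i + 1, ..., i + k and collects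
    the weights on the way. *)
Lemma cyclic_mx_exp s k (U : 'M[R]_p) :
  U = iter k (mulmx (cyclic_mx s)) 1%:M ->
  forall i j, U i j = (\prod_(t < k) s (i + t%:R)) *+ (j == i + k%:R).
Proof.
elim: k U => [|k IHk] U -> i j; first by rewrite mxE big_ord0 addr0 eq_sym.
rewrite iterS mxE (bigD1 (i + 1)) //= big1 => [|l /negPf li].
  rewrite addr0 (IHk _ erefl) !mxE eqxx mulr1n mulrnAr big_ord_recl addr0.
  rewrite mulrS addrA; congr (s i * _ *+ _).
  by apply: eq_bigr => t _; rewrite /= mulrS addrA.
by rewrite mxE li mul0r.
Qed.

(** After as many steps as there are rows every path is closed and has met each
    weight once. *)
Lemma cyclic_mx_expn s :
  iter p (mulmx (cyclic_mx s)) 1%:M = (\prod_i s i)%:M.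
Proof.
apply/matrixP => i j; rewrite (cyclic_mx_exp erefl) mxE.
have -> : p%:R = 0 :> 'I_p by rewrite Zp_nat; apply: val_inj; rewrite /= modnn.
rewrite addr0 eq_sym; congr (_ *+ _); rewrite [RHS](reindex_inj (addrI i)).
by apply: eq_bigr => t _; rewrite natr_Zp.
Qed.

(** Both E_ij C and C E_(i+1, j+1) are multiples of E_(i, j+1), by s j and s i
    respectively; as s i is its own inverse, the coefficient s i * s j * x
    makes the two sides agree. *)
Lemma cyclic_mx_conj s i j x : s i * s i = 1 ->
  cyclic_mx s *m transvection (i + 1) (j + 1) (s i * s j * x) =
  transvection i j x *m cyclic_mx s.
Proof.
move=> ss; rewrite /transvection mulmxDl mulmxDr mul1mx mulmx1; congr (_ + _).
rewrite -scalemxAl -scalemxAr.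
have -> : cyclic_mx s *m delta_mx (i + 1) (j + 1) = s i *: delta_mx i (j + 1).
  apply/matrixP => k l; rewrite !mxE (bigD1 (i + 1)) //= big1 => [|r /negPf ri].
    rewrite !mxE eqxx addr0 (inj_eq (addIr 1)) eq_sym.
    by have [->|] := eqVneq k i; rewrite ?mulr1n // mul0r mulr0.
  by rewrite !mxE ri mulr0.
have -> : delta_mx i j *m cyclic_mx s = s j *: delta_mx i (j + 1).
  apply/matrixP => k l; rewrite !mxE (bigD1 j) //= big1 => [|r /negPf rj].
    by rewrite !mxE eqxx andbT addr0 -mulnb natrM -mulr_natr; ring.
  by rewrite !mxE rj andbF mul0r.
by rewrite !scalerA -[x in RHS]mul1r -ss; congr (_ *: _); ring.
Qed.

Definition corner_sign (i : 'I_p) : R := (-1) ^+ (n.+1 * (i == ord_max)).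

Lemma corner_sign_sqr i : corner_sign i * corner_sign i = 1.
Proof. by rewrite /corner_sign -expr2 exprAC sqrrN !expr1n. Qed.

Lemma prod_corner_sign : \prod_i corner_sign i = (-1) ^+ n.+1.
Proof.
rewrite (bigD1 ord_max) //= big1 => [|i /negPf ni].
  by rewrite /corner_sign eqxx muln1 mulr1.
by rewrite /corner_sign ni muln0.
Qed.

Lemma a_mx_cyclic : map_mx intr (a_mx p) = cyclic_mx corner_sign.
Proof.
apply/matrixP => k l; rewrite mxE a_mxE rmorphD rmorphM /= rmorphXn /= rmorphN1.
rewrite !rmorph_nat mxE /corner_sign.
have [->|k_max] := eqVneq k ord_max.
  have -> : ord_max + 1 = 0 :> 'I_p.
    by apply: val_inj; rewrite /= addn1 modnn.
  rewrite /= eqxx (ltn_eqF (ltn_ord l)) add0r muln1.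
  by rewrite mulr_natr.
have lt_k : (k.+1 < p)%N.
  by rewrite ltn_neqAle ltn_ord andbT eqSS; apply: contra k_max.
rewrite (ltn_eqF lt_k) mulr0 addr0 muln0 expr0; congr _%:R.
by rewrite -val_eqE /= addn1 modn_small.
Qed.

Lemma b_mx_transvection : map_mx intr (b_mx p) = transvection 1 0 1 :> 'M[R]_p.
Proof.
apply/matrixP => k l; rewrite !mxE rmorphD /= !rmorph_nat mul1r.
by rewrite -!val_eqE.
Qed.

End CyclicMonomial.

(** * Transvections in a subgroup containing a cyclic shift *)

Section Generation.
Variables (R : finComNzRingType) (n : nat).
Local Notation p := n.+2.
Variable H : {group {'SL_p[R]}}.

(** Quantifying over all u with the given matrix spares a proof of i <> j in
    the definition. *)
Definition contains_transvections (i j : 'I_p) :=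
  forall x u, SLval u = transvection i j x -> u \in H.

Definition SL_transvection (i j : 'I_p) (x : R) (ij : i != j) : {'SL_p[R]} :=
  SL (introT eqP (det_transvection x ij)).

Lemma contains_conj s a i j : a \in H -> SLval a = cyclic_mx s ->
    s i * s i = 1 -> i != j ->
  contains_transvections (i + 1) (j + 1) -> contains_transvections i j.
Proof.
move=> Ha aE ss ij Hij x u uE.
have ij1 : i + 1 != j + 1 by rewrite (inj_eq (addIr 1)).
pose w := SL_transvection (s i * s j * x) ij1.
rewrite -(groupMr _ Ha) (_ : (u * a = a * w)%g); last first.
  by apply: val_inj; rewrite /= uE aE cyclic_mx_conj.
by rewrite groupM // (Hij (s i * s j * x)).
Qed.

Lemma contains_comm i j k : i != j -> j != k -> k != i ->
  contains_transvections i j -> contains_transvections j k ->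
  contains_transvections i k.
Proof.
move=> ij jk ki Hij Hjk x u uE.
rewrite (_ : u = (SL_transvection x ij * SL_transvection 1%R jk *
           (SL_transvection (- x) ij * SL_transvection (- 1) jk))%g).
  have Tij y : SL_transvection y ij \in H by apply: (Hij y).
  have Tjk y : SL_transvection y jk \in H by apply: (Hjk y).
  by rewrite !groupM.
by apply: val_inj; rewrite [LHS]uE -(transvection_comm x ij jk ki).
Qed.

(** Shifting (1, 0) reaches all (i, i - 1); these pairs form a directed cycle
    through all indices, and any two distinct indices are joined by a path
    along which the commutators compose. *)
Lemma contains_all s a : a \in H -> SLval a = cyclic_mx s ->
    (forall i, s i * s i = 1) -> contains_transvections 1 0 ->
  forall i j, i != j -> contains_transvections i j.
Proof.
move=> Ha aE ss H10.
have nz k : (0 < k < p)%N -> k%:R != 0 :> 'I_p.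
  by case/andP=> k0 kp; rewrite Zp_nat -val_eqE /= modn_small // -lt0n.
have Hsub k : contains_transvections (1 - k%:R) (- k%:R).
  elim: k => [|k IHk]; first by rewrite oppr0 addr0.
  apply: (contains_conj Ha aE) => //.
    by rewrite -subr_eq0 opprK subrK oner_eq0.
  by rewrite mulrSr opprD addrA !subrK.
have Hpred i : contains_transvections i (i - 1).
  by have := Hsub (1 - i : 'I_p); rewrite natr_Zp opprB addrC subrK.
(* The bound k < p keeps i, i - k and i - (k + 1) distinct, as the commutator
   formula requires. *)
have Hdist k i : (0 < k < p)%N -> contains_transvections i (i - k%:R).
  elim: k => [|[|k] IHk] // kp.
  apply: (@contains_comm _ (i - k.+1%:R)).
  - by rewrite -subr_eq0 subKr nz //= ltnW.
  - rewrite -subr_eq0 opprB addrC addrA subrK mulrSr addrAC subrr add0r.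
    exact: oner_neq0.
  - by rewrite -subr_eq0 addrAC subrr add0r oppr_eq0 nz.
  - by apply: IHk; apply: ltnW.
  - by rewrite [k.+2%:R]mulrSr opprD addrA.
move=> i j ij.
have := @Hdist (i - j : 'I_p) i; rewrite natr_Zp subKr; apply.
by rewrite ltn_ord andbT lt0n; apply: contra ij => /eqP d0;
   rewrite -subr_eq0; apply/eqP/val_inj.
Qed.

Lemma elementary_mem (A : 'M[R]_p) :
  (forall i j, i != j -> contains_transvections i j) ->
  elementary A -> forall u, SLval u = A -> u \in H.
Proof.
move=> Hij; elim=> {A} [u uE|i j x ij u|A B eA HA eB HB u uE].
- by rewrite (_ : u = 1%g) ?group1 //; apply: val_inj.
- exact: Hij.
have dA := introT eqP (elementary_det eA).
have dB := introT eqP (elementary_det eB).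
rewrite (_ : u = (SL dA * SL dB)%g); last by apply: val_inj.
by apply: groupM; [apply: HA | apply: HB].
Qed.

End Generation.

(** * The reductions of the two generators modulo m *)

Section Reduction.
Variables (n m : nat).
Local Notation p := n.+2.
Local Notation a := (SLred m (a_SL p)).
Local Notation b := (SLred m (b_SL p)).

Lemma SLred_a : SLval a = cyclic_mx (@corner_sign 'Z_m n).
Proof. exact: a_mx_cyclic. Qed.

Lemma SLred_b_exp k : SLval (b ^+ k)%g = transvection 1 0 k%:R.
Proof.
elim: k => [|k IHk]; first by rewrite transvection0.
by rewrite expgS SLvalM IHk [SLval b]b_mx_transvection transvectionD // mulrS.
Qed.

Lemma SLred_a_expn : SLval (a ^+ p)%g = ((-1) ^+ n.+1)%:M.
Proof.
have aX k : SLval (a ^+ k)%g = iter k (mulmx (SLval a)) 1%:M.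
  by elim: k => // k IHk; rewrite expgS SLvalM IHk.
by rewrite aX SLred_a cyclic_mx_expn prod_corner_sign.
Qed.

Lemma generated_SL : <<[set a; b]>>%g = [set: {'SL_p['Z_m]}].
Proof.
apply/eqP; rewrite eqEsubset subsetT /=; apply/subsetP => u _.
have Ha : a \in <<[set a; b]>>%G by rewrite mem_gen // !inE eqxx.
have Hb : b \in <<[set a; b]>>%G by rewrite mem_gen // !inE eqxx orbT.
apply: (elementary_mem (contains_all Ha SLred_a (@corner_sign_sqr _ _) _) _ erefl).
  move=> x v vE; rewrite (_ : v = (b ^+ x)%g) ?groupX //.
  by apply: val_inj; rewrite [RHS]SLred_b_exp natr_Zp.
by apply: (elementary_SL (@Zp_euclid m)); rewrite det_SL.
Qed.

Lemma order_b : (1 < m)%N -> #[b]%g = m.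
Proof.
move=> m_gt1; apply/eqP; rewrite eqn_dvd order_dvdn; apply/andP; split.
  by apply/eqP/val_inj; rewrite [LHS]SLred_b_exp pchar_Zp // transvection0.
have /matrixP/(_ 1 0) : transvection 1 0 #[b]%g%:R = 1%:M :> 'M['Z_m]_p.
  by rewrite -SLred_b_exp expg_order.
rewrite !mxE /= add0r mulr1 => /(congr1 val).
by rewrite /= val_Zp_nat // => /eqP.
Qed.

Lemma order_a_odd : odd p -> (#[a]%g %| p)%N.
Proof.
rewrite /= negbK => n_odd; rewrite order_dvdn; apply/eqP/val_inj.
by rewrite [LHS]SLred_a_expn -signr_odd /= n_odd.
Qed.

Lemma order_a_dvd_double : (#[a]%g %| 2 * p)%N.
Proof.
rewrite order_dvdn mulnC expgM; apply/eqP/val_inj.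
by rewrite expgS expg1 [LHS]SLvalM SLred_a_expn -scalar_mxM -expr2 sqrr_sign.
Qed.

End Reduction.

Local Close Scope ring_scope.

Theorem corollary5p2 (n m : nat) (hn : 3 <= n) (hm : 2 <= m) :
  [/\ <<[set SLred m (a_SL n); SLred m (b_SL n)]>>%g = [set: {'SL_n['Z_m]}],
      #[SLred m (b_SL n)]%g = m,
      odd n -> #[SLred m (a_SL n)]%g %| n
    & ~~ odd n -> #[SLred m (a_SL n)]%g %| 2 * n].
Proof.
case: n hn => [|[|n]] // _; split; first exact: generated_SL.
- exact: order_b.
- exact: order_a_odd.
- by move=> _; apply: order_a_dvd_double.
Qed.
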